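(* Let $Z$ be the set of trajectory parameters available to the planner, and for $z\in Z$ let $q_z$ be the corresponding candidate robot trajectory over timesteps $1,\dots,N$, all trajectories starting from the robot's current state at timestep $1$. Let $J(q_z)$ be the MPEPC cost and $\tilde J(q_z)$ the modified cost, both defined in the context. Suppose the robot is already in a collision state at timestep $1$. Then the modified cost maintains the MPEPC property of avoiding motion in a collision state: if every minimizer $z\in Z$ of $z\mapsto J(q_z)$ yields a trajectory $q_z$ along which the robot does not move, then every minimizer $z\in Z$ of $z\mapsto\tilde J(q_z)$ yields a trajectory $q_z$ along which the robot does not move.
   Context: Fix $N\ge1$, constants $\sigma_d,\sigma_{1/TTC},\sigma_{1/TTG}>0$ and a weight $0<a<1$. All quantities below depend on the trajectory $q_z$. For timestep $k$, $d_{o,k}\in[0,\infty)$ is the distance to the closest obstacle and $TTC_k\in[0,\infty]$ is the time to collision, i.e. the time before a collision if robot and obstacle continue their current motion ($TTC=0$ means already in collision, $TTC=\infty$ means no collision ever). The robot is in a collision state at timestep $1$ if $d_{o,1}=0$; by the definition of time to collision, $TTC_1=0$ in that case. Since all candidate trajectories start from the same current state, this holds for all of them simultaneously. Original collision probability and survivability: $$p_{c_k}=\exp(-d_{o,k}^2/\sigma_d^2),\qquad p_{s_i}=\prod_{k=1}^i(1-p_{c_k}).$$ Modified collision probability and survivability: $$\tilde p_{c_k}=\exp\left(-\frac{d_{o,k}^2}{\sigma_d^2}\right)\left(1-a\exp\left(-\frac{(1/TTC_k)^2}{\sigma_{1/TTC}^2}\right)\right),\qquad \tilde p_{s_i}=\prod_{k=1}^i(1-\tilde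 p_{c_k}).$$ For each timestep $i$ there are real-valued costs $J_{progress_i}$ (progress toward the goal), $J_{action_i}$ (cost of applying large actions) and $J_{collision_i}$ (cost of collision), which are the same in both cost functions. The MPEPC cost is $$J(q_z)=\sum_{i=1}^N\Big(p_{s_i}J_{progress_i}+J_{action_i}+(1-p_{s_i})J_{collision_i}\Big),$$ and the modified cost is $$\tilde J(q_z)=\sum_{i=1}^N\Big(\tilde p_{s_i}J_{progress_i}+J_{action_i}+(1-\tilde p_{s_i})J_{collision_i}\Big)+J_{terminal},$$ where $$J_{terminal}=-p_{s_N}\,C_{TTG}\,C_{TTC},\qquad C_{TTG}=\exp\left(-\frac{1/TTG^2}{\sigma_{1/TTG}^2}\right),\qquad C_{TTC}=\exp\left(-\frac{1/TTC^2}{\sigma_{1/TTC}^2}\right).$$ Here, in $J_{terminal}$, $TTG$ and $TTC$ are values in $[0,\infty]$ computed at the terminal state of $q_z$: $TTG$ is the expected time to goal (Euclidean distance to the goal divided by the component of the terminal velocity in the goal direction, taken to be $\infty$ if there is no such component), and $TTC$ is the time to collision assuming the robot keeps its terminal orientation and travels at maximum velocity. Conventions: $1/\infty=0$, $1/0=\infty$ and $\exp(-\infty)=0$, so that $C_{TTG},C_{TTC}\in[0,1]$. The robot does not move along $q_z$ if its pose is constant over timesteps $1,\dots,N$. *)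

(* Defs.v *)
From mathcomp Require Import all_boot all_order all_algebra.
From mathcomp Require Import all_classical all_reals all_analysis.
Set Implicit Arguments.
Unset Strict Implicit.
Unset Printing Implicit Defensive.
Import Order.TTheory GRing.Theory Num.Theory.
Local Open Scope classical_set_scope.
Local Open Scope ring_scope.

Definition plane (R : realType) : Type := (R * R)%type.

(* The library norm on a product is the max norm, so the Euclidean distance is
   written out. *)
Definition edist (R : realType) (x y : plane R) : R :=
  Num.sqrt ((x.1 - y.1) ^+ 2 + (x.2 - y.2) ^+ 2).

Record pose (R : realType) := Pose {
  position : plane R;
  heading : R
}.

Record robotState (R : realType) := RobotState {
  robot_pose : pose R;
  linear_velocity : plane R;
  angular_velocity : R
}.

(* There are N = n.+1 timesteps; timestep k = 1, ..., N is the ordinal k - 1, so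
   timestep 1 is ord0 and timestep N is ord_max. *)
Definition trajectory (R : realType) (n : nat) : Type :=
  'I_n.+1 -> robotState R.

(* [footprint c] is the set of points covered by the robot at pose c, and
   [obstacle j k t] the set covered by the j-th obstacle t time units after
   timestep k if from timestep k on it continues the motion it has then; so
   [obstacle j k 0] is where it is at timestep k.  Likewise [coast s t] is the
   pose reached from the state s after continuing the current motion for t.
   There is at least one obstacle, which makes all distances finite. *)
Record environment (R : realType) (n : nat) := Environment {
  goal : plane R;
  vmax : R;
  vmax_ge0 : 0 <= vmax;
  footprint : pose R -> set (plane R);
  footprint_neq0 : forall c, footprint c !=set0;
  coast : robotState R -> R -> pose R;
  coast0 : forall s, coast s 0 = robot_pose s;
  obstacles : nat;
  obstacle : 'I_obstacles.+1 -> 'I_n.+1 -> R -> set (plane R);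
  obstacle_neq0 : forall j k t, obstacle j k t !=set0
}.

Definition gap (R : realType) (A B : set (plane R)) : R :=
  inf [set edist x y | x in A & y in B].

(* Distance from the robot at pose c to the closest obstacle, the obstacles
   being extrapolated from timestep k by the time t. *)
Definition clearance (R : realType) (n : nat) (E : environment R n)
    (c : pose R) (k : 'I_n.+1) (t : R) : R :=
  \big[Num.min/gap (footprint E c) (obstacle (e := E) ord0 k t)]_j
    gap (footprint E c) (obstacle (e := E) j k t).

Definition obs_dist (R : realType) (n : nat) (E : environment R n)
    (q : trajectory R n) (k : 'I_n.+1) : R :=
  clearance E (robot_pose (q k)) k 0.

(* First collision time from timestep k on, when the robot pose after time t
   is [motion t]; the infimum of the empty set is +oo. *)
Definition collision_time (R : realType) (n : nat) (E : environment R n)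
    (motion : R -> pose R) (k : 'I_n.+1) : \bar R :=
  ereal_inf
    [set t%:E | t in [set t : R | 0 <= t /\ clearance E (motion t) k t = 0]].

Definition TTC (R : realType) (n : nat) (E : environment R n)
    (q : trajectory R n) (k : 'I_n.+1) : \bar R :=
  collision_time E (coast E (q k)) k.

(* Straight motion at maximum velocity with the orientation of c. *)
Definition cruise (R : realType) (n : nat) (E : environment R n)
    (c : pose R) (t : R) : pose R :=
  Pose ((position c).1 + t * vmax E * cos (heading c),
        (position c).2 + t * vmax E * sin (heading c))
       (heading c).

Definition terminal_TTC (R : realType) (n : nat) (E : environment R n)
    (q : trajectory R n) : \bar R :=
  collision_time E (cruise E (robot_pose (q ord_max))) ord_max.

(* Component of the velocity in the direction of the goal; it is 0 when the
   robot is at the goal, where that direction is undefined. *)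
Definition goal_speed (R : realType) (n : nat) (E : environment R n)
    (s : robotState R) : R :=
  let p := position (robot_pose s) in
  let v := linear_velocity s in
  (v.1 * ((goal E).1 - p.1) + v.2 * ((goal E).2 - p.2)) / edist p (goal E).

Definition terminal_TTG (R : realType) (n : nat) (E : environment R n)
    (q : trajectory R n) : \bar R :=
  let s := q ord_max in
  if 0 < goal_speed E s
  then (edist (position (robot_pose s)) (goal E) / goal_speed E s)%:E
  else +oo%E.

(* exp (- (1/T)^2 / sigma^2), with 1/0 = +oo, 1/+oo = 0 and exp(-oo) = 0; for
   T >= 0 and sigma > 0 the extended real is in [0, 1], so [fine] loses
   nothing. *)
Definition inv_time_exp (R : realType) (sigma : R) (T : \bar R) : R :=
  fine (expeR (- ((T^-1) ^+ 2 / (sigma ^+ 2)%:E)))%E.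

Definition pc (R : realType) (n : nat) (E : environment R n) (sd : R)
    (q : trajectory R n) (k : 'I_n.+1) : R :=
  expR (- (obs_dist E q k ^+ 2 / sd ^+ 2)).

Definition ps (R : realType) (n : nat) (E : environment R n) (sd : R)
    (q : trajectory R n) (i : 'I_n.+1) : R :=
  \prod_(k < n.+1 | (k <= i)%N) (1 - pc E sd q k).

Definition pc_mod (R : realType) (n : nat) (E : environment R n)
    (sd sttc a : R) (q : trajectory R n) (k : 'I_n.+1) : R :=
  expR (- (obs_dist E q k ^+ 2 / sd ^+ 2)) *
  (1 - a * inv_time_exp sttc (TTC E q k)).

Definition ps_mod (R : realType) (n : nat) (E : environment R n)
    (sd sttc a : R) (q : trajectory R n) (i : 'I_n.+1) : R :=
  \prod_(k < n.+1 | (k <= i)%N) (1 - pc_mod E sd sttc a q k).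

Record stage_costs (R : realType) (n : nat) := StageCosts {
  J_progress : trajectory R n -> 'I_n.+1 -> R;
  J_action : trajectory R n -> 'I_n.+1 -> R;
  J_collision : trajectory R n -> 'I_n.+1 -> R
}.

Definition J_mpepc (R : realType) (n : nat) (E : environment R n)
    (C : stage_costs R n) (sd : R) (q : trajectory R n) : R :=
  \sum_(i < n.+1) (ps E sd q i * J_progress C q i + J_action C q i +
                   (1 - ps E sd q i) * J_collision C q i).

Definition J_terminal (R : realType) (n : nat) (E : environment R n)
    (sd sttc sttg : R) (q : trajectory R n) : R :=
  - (ps E sd q ord_max * inv_time_exp sttg (terminal_TTG E q) *
     inv_time_exp sttc (terminal_TTC E q)).

Definition J_modified (R : realType) (n : nat) (E : environment R n)
    (C : stage_costs R n) (sd sttc sttg a : R) (q : trajectory R n) : R :=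
  \sum_(i < n.+1) (ps_mod E sd sttc a q i * J_progress C q i + J_action C q i +
                   (1 - ps_mod E sd sttc a q i) * J_collision C q i) +
  J_terminal E sd sttc sttg q.

Definition minimizer (R : realType) (P : Type) (Z : set P) (f : P -> R)
    (z : P) : Prop :=
  Z z /\ forall w, Z w -> f z <= f w.

Definition does_not_move (R : realType) (n : nat) (q : trajectory R n) : Prop :=
  forall k l : 'I_n.+1, robot_pose (q k) = robot_pose (q l).

(* Main.v *)
Require Import Defs.
From mathcomp Require Import all_boot all_order all_algebra.
From mathcomp Require Import all_classical all_reals all_analysis.
Import Order.TTheory GRing.Theory Num.Theory.
Local Open Scope classical_set_scope.
Local Open Scope ring_scope.

(** A collision at timestep 1 makes the first factor of both survivabilities
    vanish, so both are zero at every timestep and the terminal cost vanishes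
    too. The two cost functions therefore coincide on [Z], and so do their
    minimizers. *)

(** The time 0 lies in the set whose infimum is taken, and every time in that set is nonnegative. *)
Lemma collision_time_eq0 (R : realType) (n : nat) (E : environment R n)
    (motion : R -> pose R) (k : 'I_n.+1) :
  clearance E (motion 0) k 0 = 0 -> collision_time E motion k = 0%E.
Proof.
move=> c0; apply/eqP; rewrite eq_le; apply/andP; split.
- by apply: ereal_inf_lbound; exists 0.
- by apply: le_ereal_inf_tmp => _ [t [t0 _] <-]; rewrite lee_fin.
Qed.

(** As [0^-1 = +oo] in the extended reals, and dividing by the positive finite [sigma ^+ 2] keeps
    [+oo], the exponent is [-oo]. *)
Lemma inv_time_exp0 (R : realType) (sigma : R) :
  0 < sigma -> inv_time_exp sigma 0%E = 0.
Proof.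
move=> s0; have s2 : 0 < sigma ^+ 2 by rewrite exprn_gt0.
by rewrite /inv_time_exp inve0 expe2 mulyy inver gt_eqF// gt0_mulye// lte_fin invr_gt0.
Qed.

Section InitialCollision.
Context (R : realType) (n : nat) (E : environment R n).
Context (q : trajectory R n) (q_collides : obs_dist E q ord0 = 0).

Lemma ps_eq0 (sd : R) (i : 'I_n.+1) : ps E sd q i = 0.
Proof.
by rewrite /ps (bigD1 ord0)//= /pc q_collides expr0n mul0r oppr0 expR0 subrr mul0r.
Qed.

Lemma TTC_eq0 : TTC E q ord0 = 0%E.
Proof. by apply: collision_time_eq0; rewrite coast0. Qed.

(** Since [TTC] is 0 at timestep 1, the weight multiplying the exponential there is 1 whatever [a]
    is: the modified collision probability is still 1. *)
Lemma ps_mod_eq0 (sd sttc a : R) (i : 'I_n.+1) :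
  0 < sttc -> ps_mod E sd sttc a q i = 0.
Proof.
move=> sttc_gt0; rewrite /ps_mod (bigD1 ord0)//= /pc_mod TTC_eq0 inv_time_exp0//.
by rewrite q_collides expr0n mul0r oppr0 expR0 mulr0 subr0 mulr1 subrr mul0r.
Qed.

Lemma J_modified_eq_mpepc (C : stage_costs R n) (sd sttc sttg a : R) :
  0 < sttc -> J_modified E C sd sttc sttg a q = J_mpepc E C sd q.
Proof.
(* The terminal cost has the factor [ps] at [ord_max], which is 0. *)
move=> sttc_gt0; rewrite /J_modified /J_terminal ps_eq0 !mul0r oppr0 addr0.
by apply: eq_bigr => i _; rewrite ps_eq0 ps_mod_eq0.
Qed.

End InitialCollision.

Theorem mainTheorem3 (R : realType) (n : nat) (E : environment R n)
    (C : stage_costs R n) (sd sttc sttg a : R)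
    (sd_gt0 : 0 < sd) (sttc_gt0 : 0 < sttc) (sttg_gt0 : 0 < sttg)
    (a_gt0 : 0 < a) (a_lt1 : a < 1)
    (P : Type) (Z : set P) (q : P -> trajectory R n)
    (s0 : robotState R) (q_start : forall z, Z z -> q z ord0 = s0)
    (in_collision : clearance E (robot_pose s0) ord0 0 = 0) :
  (forall z, minimizer Z (fun w => J_mpepc E C sd (q w)) z ->
     does_not_move (q z)) ->
  (forall z, minimizer Z (fun w => J_modified E C sd sttc sttg a (q w)) z ->
     does_not_move (q z)).
Proof.
(* The common start [s0] puts every candidate of [Z] in collision at timestep 1. *)
have eqJ w : Z w -> J_modified E C sd sttc sttg a (q w) = J_mpepc E C sd (q w).
  by move=> Zw; apply: J_modified_eq_mpepc => //; rewrite /obs_dist q_start.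
move=> still z [Zz z_min]; apply: still; split=> // w Zw.
by rewrite -!eqJ//; exact: z_min.
Qed.
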